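(* Let $f:X\to Y$ be a continuous map between Hausdorff spaces, and let $\widetilde f:\mathrm{CL}(X)\to\mathrm{CL}(Y)$ be the induced function $\widetilde f(A)=\overline{f(A)}$. Write $\mathrm{CL}_{F^+}$ and $\mathrm{CL}_F$ for $\mathrm{CL}$ equipped with the upper Fell topology and the Fell topology, respectively. (1) If $Y$ is locally compact and $f$ is proper, then $\widetilde f:\mathrm{CL}_{F^+}(X)\to\mathrm{CL}_{F^+}(Y)$ is continuous. In particular, $\widetilde f:\mathrm{CL}_F(X)\to\mathrm{CL}_F(Y)$ is continuous. (2) If $f$ is perfect, then $\widetilde f:\mathrm{CL}_{F^+}(X)\to\mathrm{CL}_{F^+}(Y)$ is continuous. In particular, $\widetilde f:\mathrm{CL}_F(X)\to\mathrm{CL}_F(Y)$ is continuous. (3) If $f$ is closed and non constant and $\widetilde f:\mathrm{CL}_F(X)\to\mathrm{CL}_F(Y)$ is continuous, then $f^{-1}(y)$ is compact for every $y\in f(X)$ (namely, $f$ is perfect). (4) If $f$ is closed, then $\widetilde f:\mathrm{CL}_F(X)\to\mathrm{CL}_F(Y)$ is continuous if and only if $f$ is perfect or constant.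
   Context: For a Hausdorff space $X$, $\mathrm{CL}(X)$ denotes the family of all nonempty closed subsets of $X$. For $Q\subset X$ let $Q^-=\{A\in\mathrm{CL}(X): A\cap Q\neq\emptyset\}$ and $Q^+=\{A\in\mathrm{CL}(X): A\subset Q\}$. The lower Vietoris topology on $\mathrm{CL}(X)$ is the topology generated by all sets $U^-$ with $U\subset X$ open. The upper Fell topology on $\mathrm{CL}(X)$ is the topology generated by all sets $(X\setminus K)^+$ with $K\subset X$ compact. The Fell topology is the topology generated by the union of the lower Vietoris topology and the upper Fell topology. A map is closed if it sends closed sets to closed sets. A continuous map $f:X\to Y$ is proper if $f^{-1}(K)$ is compact for every compact $K\subset Y$, and perfect if $f$ is closed and every fiber $f^{-1}(y)$ is compact. *)

(* Defs.v *)
From HB Require Import structures.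
From mathcomp Require Import all_boot all_classical.
From mathcomp Require Import topology.

Set Implicit Arguments.
Unset Strict Implicit.
Unset Printing Implicit Defensive.

Local Open Scope classical_set_scope.

Section Hyperspace.
Variable X : topologicalType.

Definition CL : Type := [set A : set X | closed A /\ A !=set0].
HB.instance Definition _ := Choice.on CL.

(* Q^- and Q^+ respectively. *)
Definition hit (Q : set X) : set CL := [set A | \val A `&` Q !=set0].
Definition inside (Q : set X) : set CL := [set A | \val A `<=` Q].

(* Distinct aliases of CL, so that each can carry its own canonical topology. *)
Definition CL_lowerVietoris : Type := CL.
HB.instance Definition _ := Choice.on CL_lowerVietoris.
HB.instance Definition _ := isSubBaseTopological.Build CL_lowerVietoris
  [set hit U | U in open] id.

Definition CL_upperFell : Type := CL.
HB.instance Definition _ := Choice.on CL_upperFell.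
HB.instance Definition _ := isSubBaseTopological.Build CL_upperFell
  [set inside (~` K) | K in compact] id.

Definition CL_Fell : Type := CL.
HB.instance Definition _ := Choice.on CL_Fell.
HB.instance Definition _ := isSubBaseTopological.Build CL_Fell
  ((open : set (set CL_lowerVietoris)) `|` (open : set (set CL_upperFell))) id.

End Hyperspace.

Section Maps.
Variables X Y : topologicalType.
Implicit Type f : X -> Y.

Definition closed_map f := forall A : set X, closed A -> closed (f @` A).

Definition proper_map f :=
  continuous f /\ forall K : set Y, compact K -> compact (f @^-1` K).

Definition perfect_map f :=
  [/\ continuous f, closed_map f & forall y : Y, compact (f @^-1` [set y])].

(* Stated without a witness in Y so that the map from an empty X is constant. *)
Definition constant_map f := forall x x' : X, f x = f x'.

Lemma CL_image_subproof f (A : CL X) :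
  closure (f @` \val A) \in [set B : set Y | closed B /\ B !=set0].
Proof.
apply/mem_set; split; first exact: closed_closure.
have [_ [x Ax]] := set_valP A.
by exists (f x); apply: subset_closure; exists x.
Qed.

Definition CL_image f (A : CL X) : CL Y := SigSub (CL_image_subproof f A).

End Maps.

(* Main.v *)
(** The preimage of [(Y \ K)^+] under the induced map is [(X \ f^-1 K)^+] as soon
    as [f] is closed, so closed proper maps induce upper Fell continuous maps;
    perfect maps are proper, and proper maps into locally compact Hausdorff
    spaces are closed. The lower Vietoris part is continuous for every
    continuous [f]. Conversely, if the fiber of [y] is not compact and
    [f x1 <> y], let [a] run through that fiber and leave every compact set:
    [{x1, a}] Fell-converges to [{x1}], whereas its image always contains [y],
    so it stays out of the neighborhood [(Y \ {y})^+] of [{f x1}]. *)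

Require Import Defs.
From mathcomp Require Import all_boot all_classical.
From mathcomp Require Import topology.

Local Open Scope classical_set_scope.

(** * Convergence and continuity tested on a subbase *)

Definition subbase {T : topologicalType} (D : set (set T)) :=
  open = [set \bigcup_(U in E) U | E in subset^~ (finI_from D id)] :> set (set T).

Section Subbase.
Context {T : topologicalType} {D : set (set T)}.
Hypothesis sD : subbase D.

Lemma subbase_open (U : set T) : D U -> open U.
Proof.
move=> DU; rewrite sD; exists [set U]; last exact: bigcup_set1.
by move=> _ ->; exact: (@finI_from1 _ _ D id).
Qed.

Lemma subbase_cvg (F : set_system T) (x : T) : Filter F ->
  (forall U, D U -> U x -> F U) -> F --> x.
Proof.
move=> FF DF A; rewrite nbhsE => -[B [oB Bx] BA]; apply: filterS BA _.
move: oB Bx; rewrite sD => -[E ED <-] [V EV Vx].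
apply: (@filterS _ _ _ V); first by move=> y Vy; exists V.
have [K KD VE] := ED _ EV; rewrite -VE in Vx *.
by apply: filter_bigI => U KU; apply: DF; [exact/set_mem/KD|exact: Vx].
Qed.

Lemma subbase_continuous (S : topologicalType) (g : S -> T) :
  (forall U, D U -> open (g @^-1` U)) -> continuous g.
Proof.
move=> oD x; apply: subbase_cvg => U DU Ux.
by apply: open_nbhs_nbhs; split => //; exact: oD.
Qed.

End Subbase.

Section HyperspaceSubbases.
Variable X : topologicalType.

(** This and the next two facts hold by conversion, since [subbase] copies the description of [open]
    that [isSubBaseTopological] installs. *)
Lemma subbase_lowerVietoris :
  subbase ([set hit U | U in open] : set (set (CL_lowerVietoris X))).
Proof. by []. Qed.

Lemma subbase_upperFell :
  subbase ([set inside (~` K) | K in compact] : set (set (CL_upperFell X))).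
Proof. by []. Qed.

Lemma subbase_Fell :
  subbase (@open (CL_lowerVietoris X) `|` @open (CL_upperFell X)
           : set (set (CL_Fell X))).
Proof. by []. Qed.

Lemma cvg_Fell (F : set_system (CL_Fell X)) (A : CL_Fell X) : Filter F ->
  (forall U, open U -> hit U A -> F (hit U)) ->
  (forall K, compact K -> inside (~` K) A -> F (inside (~` K))) ->
  F --> A.
Proof.
move=> FF FU FK; apply: (subbase_cvg subbase_Fell) => W [oW WA|oW WA].
  (* The aliases of [CL X] share one carrier, so [F] can be read as a filter for either coarser
     topology. *)
  have FA : (F : set_system (CL_lowerVietoris X)) --> (A : CL_lowerVietoris X).
    by apply: (subbase_cvg subbase_lowerVietoris) => _ [U oU <-]; exact: FU.
  by apply: FA; exact: open_nbhs_nbhs.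
have FA : (F : set_system (CL_upperFell X)) --> (A : CL_upperFell X).
  by apply: (subbase_cvg subbase_upperFell) => _ [K cK <-]; exact: FK.
by apply: FA; exact: open_nbhs_nbhs.
Qed.

Lemma open_inside (K : set X) : compact K ->
  open (inside (~` K) : set (CL_upperFell X)).
Proof. by move=> cK; apply: (subbase_open subbase_upperFell); exists K. Qed.

Lemma open_hit (U : set X) : open U ->
  open (hit U : set (CL_lowerVietoris X)).
Proof. by move=> oU; apply: (subbase_open subbase_lowerVietoris); exists U. Qed.

Lemma open_inside_Fell (K : set X) : compact K ->
  open (inside (~` K) : set (CL_Fell X)).
Proof.
by move=> cK; apply: (subbase_open subbase_Fell); right; exact: open_inside.
Qed.

End HyperspaceSubbases.

(** * Continuity of the induced map; perfect, proper and closed maps *)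

Section ContinuousMaps.
Context {X Y : topologicalType} {f : X -> Y}.

(** An open set that meets the closure of an image already meets the image. *)
Lemma CL_image_lowerVietoris_continuous : continuous f ->
  continuous (CL_image f : CL_lowerVietoris X -> CL_lowerVietoris Y).
Proof.
move=> cf; apply: (subbase_continuous (subbase_lowerVietoris Y)) => _ [U oU <-].
suff -> : (CL_image f : CL_lowerVietoris X -> CL_lowerVietoris Y) @^-1` hit U =
    hit (f @^-1` U).
  by apply: open_hit; apply: open_comp => // x _; exact: cf.
apply/seteqP; split=> A [].
  move=> y [/= fAy Uy].
  have [_ [[x Ax <-] Ufx]] := fAy U (open_nbhs_nbhs (conj oU Uy)).
  by exists x.
by move=> x [Ax Ufx]; exists (f x); split=> //; apply: subset_closure; exists x.
Qed.

Lemma CL_image_Fell_continuous : continuous f ->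
  continuous (CL_image f : CL_upperFell X -> CL_upperFell Y) ->
  continuous (CL_image f : CL_Fell X -> CL_Fell Y).
Proof.
move=> cf cU; apply: (subbase_continuous (subbase_Fell Y)) => W [oW|oW];
  apply: (subbase_open (subbase_Fell X)).
- left; move/continuousP: (CL_image_lowerVietoris_continuous cf); exact.
- by right; move/continuousP: cU; exact.
Qed.

Lemma closed_proper_CL_image_upperFell_continuous :
  closed_map f -> proper_map f ->
  continuous (CL_image f : CL_upperFell X -> CL_upperFell Y).
Proof.
move=> clf [_ pf]; apply: (subbase_continuous (subbase_upperFell Y)) =>
  _ [K cK <-].
suff -> : (CL_image f : CL_upperFell X -> CL_upperFell Y) @^-1` inside (~` K) =
    inside (~` (f @^-1` K)) by apply: open_inside; exact: pf.
apply/seteqP; split=> A sA /= x Ax.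
  by apply: sA; apply: subset_closure; exists x.
(* Closedness of [f] enters here: the image of [A] is its own closure, so [x] has a preimage in
   [A]. *)
have [clA _] := set_valP A.
rewrite /CL_image /= -((closure_id _).1 (clf _ clA)) in Ax.
by case: Ax => z Az <-; exact: sA.
Qed.

(* If [F] is a filter on the preimage of [K] whose image clusters at [y], then
   [y] lies in the closed sets [f @` closure G], so the sets [closure G] with
   [F G] trace a filter base on the fiber of [y]. *)
Lemma perfect_map_proper : perfect_map f -> proper_map f.
Proof.
move=> [cf clf cfib]; split=> // K cK F PF FK.
have [y [Ky cly]] : K `&` cluster (f @ F) !=set0 by exact: cK.
pose H := filter_from F (fun G => closure G `&` f @^-1` [set y]).
have PH : ProperFilter H.
  apply: filter_from_proper.
    apply: filter_from_filter; first by exists setT; exact: filterT.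
    move=> A B FA FB; exists (A `&` B); first exact: filterI.
    move=> x [clAB fx]; split; split=> //; apply: closureS clAB.
      exact: subIsetl.
    exact: subIsetr.
  move=> G FG; have [x Gx fx] : (f @` closure G) y.
    rewrite ((closure_id _).1 (clf _ (@closed_closure _ G))) => V Vy.
    apply: cly Vy => /=; apply: filterS FG => x Gx.
    by exists x => //; exact: subset_closure.
  by exists x.
have [|x [fx clx]] := cfib y H PH.
  by exists setT; [exact: filterT|move=> x []].
exists x; split; first by rewrite /= fx.
(* Being a cluster point of [H], [x] adheres to each [closure G], hence lies in it. *)
rewrite clusterE => G FG; rewrite ((closure_id _).1 (@closed_closure _ G)).
by move=> V Vx; apply: clx Vx; exists G => // z [].
Qed.

(** Near a limit point of the image of [A], only the part of [A] over a compact neighborhood [U]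
    matters; by properness that part is compact, so its image is compact, hence closed. *)
Lemma proper_locally_compact_closed_map : hausdorff_space Y ->
  locally_compact [set: Y] -> proper_map f -> closed_map f.
Proof.
move=> hY lcY [cf pf] A clA; apply/closure_id/seteqP.
split; first exact: subset_closure.
move=> y cly; have [U + [cU clU]] := lcY y I.
rewrite /within /= => nU.
have {}nU : nbhs y U by apply: filterS nU => z; exact.
have cAU : compact (f @` (A `&` f @^-1` U)).
  apply: continuous_compact; first by apply: continuous_subspaceT.
  rewrite setIC; apply: compact_closedI => //; exact: pf.
have [x [Ax _] <-] : (f @` (A `&` f @^-1` U)) y; last by exists x.
apply: (compact_closed hY cAU) => V Vy.
have [_ [[x Ax <-] [Vx Ux]]] := cly _ (filterI Vy nU).
by exists (f x); split=> //; exists x.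
Qed.

End ContinuousMaps.

(** * Two-point sets and noncompact fibers *)

Section Points.
Context {X : topologicalType} (hX : hausdorff_space X).

Lemma CL_pair_subproof (x a : X) :
  [set x; a] \in [set B : set X | closed B /\ B !=set0].
Proof.
apply/mem_set; split; last by exists x; left.
by apply: closedU; exact/accessible_closed_set1/hausdorff_accessible.
Qed.

(** The singleton of [x] appears as [CL_pair x x]. *)
Definition CL_pair (x a : X) : CL X := SigSub (CL_pair_subproof x a).

(* A point escaping all compact sets disappears in the Fell topology. *)
Lemma cvg_CL_pair (x : X) (F : set_system X) : Filter F ->
  (forall K, compact K -> F (~` K)) ->
  (CL_pair x : X -> CL_Fell X) @ F --> (CL_pair x x : CL_Fell X).
Proof.
move=> FF FK; apply: cvg_Fell => [U oU|K cK].
- move=> [z [/= xz Uz]]; apply: filterE => a.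
  by exists z; split=> //; case: xz => ->; left.
- move=> xK; apply: (@filterS _ F _ _ _ _ (FK _ cK)) => a Ka z /= [->|-> //].
  by apply: xK; left.
Qed.

End Points.

(** Stated for every [y], in the range or not, because [perfect_map] asks about all fibers. *)
Lemma Fell_continuous_compact_fiber {X Y : topologicalType} (f : X -> Y) (y : Y) :
  hausdorff_space X -> hausdorff_space Y -> continuous f -> ~ constant_map f ->
  continuous (CL_image f : CL_Fell X -> CL_Fell Y) -> compact (f @^-1` [set y]).
Proof.
move=> hX hY cf ncf cF; apply: contrapT => ncy.
have cl1 (z : Y) : closed [set z] by exact/accessible_closed_set1/hausdorff_accessible.
have clfib : closed (f @^-1` [set y]) by apply: preimage_closed => // x _; exact: cf.
have [x1 fx1] : exists x, f x <> y.
  apply: contrapT => /forallNP fy; apply: ncf => x x'.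
  by rewrite (contrapT (fy x)) (contrapT (fy x')).
(* [F] makes precise a point of the fiber that leaves every compact set. *)
pose F := filter_from compact (fun K : set X => f @^-1` [set y] `\` K).
have PF : ProperFilter F.
  apply: filter_from_proper.
    apply: filter_from_filter; first by exists set0; exact: compact0.
    move=> A B cA cB; exists (A `|` B); first exact: compactU.
    by move=> x [fx nAB]; split; split=> // ?; apply: nAB; [left|right].
  (* Otherwise the fiber would be a closed subset of the compact set [K]. *)
  move=> K cK; apply: contrapT => /nonemptyPn fK; apply: ncy.
  by apply: subclosed_compact clfib cK _; rewrite -setD_eq0.
have FK (K : set X) : compact K -> F (~` K) by move=> cK; exists K => // x [].
have cvgF := cvg_CL_pair hX x1 F _ FK.
have nW : nbhs (CL_image f (CL_pair hX x1 x1) : CL_Fell Y) (inside (~` [set y])).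
  apply: open_nbhs_nbhs; split; first by apply: open_inside_Fell; exact: compact_set1.
  move=> z /= + zy; rewrite {z}zy => clz.
  have nfx1 : nbhs y (~` [set f x1]).
    by apply: open_nbhs_nbhs; split; [exact/closed_openC|exact: nesym].
  by have [_ [[x [->|->] <-]]] := clz _ nfx1; apply.
have [K cK KW] : F (CL_pair hX x1 @^-1` (CL_image f @^-1` inside (~` [set y]))).
  exact: cvgF (cF _ _ nW).
have [a Fa] : (f @^-1` [set y] `\` K) !=set0.
  by apply: (@filter_ex _ F); exists K.
apply: (KW a Fa (f a)); last exact: Fa.1.
by apply: subset_closure; exists a => //; right.
Qed.

Theorem theorem3p4 (X Y : topologicalType)
  (hX : hausdorff_space X) (hY : hausdorff_space Y)
  (f : X -> Y) (cf : continuous f) :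
  [/\ locally_compact [set: Y] -> proper_map f ->
        continuous (CL_image f : CL_upperFell X -> CL_upperFell Y) /\
        continuous (CL_image f : CL_Fell X -> CL_Fell Y),
      perfect_map f ->
        continuous (CL_image f : CL_upperFell X -> CL_upperFell Y) /\
        continuous (CL_image f : CL_Fell X -> CL_Fell Y),
      closed_map f -> ~ constant_map f ->
        continuous (CL_image f : CL_Fell X -> CL_Fell Y) ->
        (forall y, range f y -> compact (f @^-1` [set y])) /\ perfect_map f
    & closed_map f ->
        (continuous (CL_image f : CL_Fell X -> CL_Fell Y) <->
         perfect_map f \/ constant_map f)].
Proof.
have uF := CL_image_Fell_continuous cf.
have pc : perfect_map f ->
    continuous (CL_image f : CL_upperFell X -> CL_upperFell Y).
  move=> pf; apply: closed_proper_CL_image_upperFell_continuous.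
    by case: pf.
  exact: perfect_map_proper.
have cp : closed_map f -> ~ constant_map f ->
    continuous (CL_image f : CL_Fell X -> CL_Fell Y) ->
    forall y, compact (f @^-1` [set y]).
  by move=> clf ncf cF y; exact: Fell_continuous_compact_fiber.
split.
- move=> lcY pf; suff cU : continuous (CL_image f : CL_upperFell X -> CL_upperFell Y).
    by split=> //; exact: uF.
  apply: closed_proper_CL_image_upperFell_continuous => //.
  exact: proper_locally_compact_closed_map.
- by move=> pf; split; [|apply: uF]; exact: pc.
- by move=> clf ncf cF; split; [move=> y _|split=> //]; exact: cp.
- move=> clf; split=> [cF|[pf|kf]].
  + by have [kf|ncf] := pselect (constant_map f); [right|left; split=> //; exact: cp].
  + exact/uF/pc.
  (* Members of [CL X] are nonempty, so a constant [f] gives them all the same one-point image. *)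
  + have cst (A B : CL X) : CL_image f A = CL_image f B.
      apply: val_inj => /=; congr closure; apply/seteqP.
      have [_ [a Aa]] := set_valP A; have [_ [b Bb]] := set_valP B.
      by split=> _ [x _ <-]; [exists b|exists a] => //; exact: kf.
    move=> A W /= /nbhs_singleton WA; apply: (@filterE _ (nbhs A)) => B.
    by rewrite /= (cst B A).
Qed.
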